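(* Let $n \geq 2$ and $m \geq 41$ be integers. Then the average degree of the graph $\mathcal{T}([m]^n)$, i.e., the average jump number $\bar{s}([m]^n)$, satisfies $$\bar{s}([m]^n) \;\geq\; m^n \left( 1 - \sqrt{\frac{48 \lg n}{\lg m}} \right).$$
   Context: Write $[m]=\{1,\ldots,m\}$, and let $\lg$ denote the logarithm to base $2$. The grid $[m]^n$ is the product of $n$ chains of length $m$, i.e., the set of vectors $(x_1,\ldots,x_n)$ with $x_i\in[m]$, ordered coordinatewise. For a finite poset $P$, a linear extension is a bijection $L: P \to \{1,\ldots,|P|\}$ such that $x \prec y$ in $P$ implies $L(x)<L(y)$; write $L^k = L^{-1}(k)$ for the $k$-th element of the ordering. The transposition graph $\mathcal{T}(P)$ is the graph whose vertices are the linear extensions of $P$, two of them being adjacent when one is obtained from the other by swapping the elements in two consecutive positions $a, a+1$ of the ordering. (Equivalently, after labelling the elements of $P$ by $\{1,\ldots,|P|\}$, it is the subgraph induced by the linear extensions in the Hasse diagram of the weak Bruhat order on permutations.) A jump of $L$ is an integer $k$ with $1\le k\le |P|-1$ such that $L^k \not\prec L^{k+1}$; the degree of $L$ in $\mathcal{T}(P)$ equals the number of jumps of $L$. The average jump number $\bar{s}(P)$ is the average of the number of jumps over all linear extensions of $P$, equivalently the average degree of $\mathcal{T}(P)$. *)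

(* Defs.v *)
From HB Require Import structures.
From mathcomp Require Import all_boot all_order all_algebra all_fingroup.
From mathcomp Require Import reals exp.

Set Implicit Arguments.
Unset Strict Implicit.
Unset Printing Implicit Defensive.

Import Order.TTheory GRing.Theory Num.Theory.
Local Open Scope ring_scope.

(* Positions are 0-based: the positions 1, ..., |P| of an ordering of P are
   the elements 0, ..., |P| - 1 of 'I_#|P|. An injection into 'I_#|P| is
   automatically a bijection (linext_bij). *)
Definition is_linext d (P : finPOrderType d) (f : {ffun P -> 'I_#|P|}) : bool :=
  injectiveb f && [forall x, forall y, (x < y)%O ==> (f x < f y)%N].

Record linext d (P : finPOrderType d) : Type := LinExt {
  linext_fun :> {ffun P -> 'I_#|P|};
  linextP : is_linext linext_fun }.

HB.instance Definition _ d (P : finPOrderType d) :=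
  [isSub for @linext_fun d P].
HB.instance Definition _ d (P : finPOrderType d) :=
  [Finite of linext P by <:].

Lemma linext_bij d (P : finPOrderType d) (L : linext P) : bijective L.
Proof.
have /andP[/injectiveP Linj _] := linextP L.
by apply: inj_card_bij => //; rewrite card_ord.
Qed.

Lemma linext_codom d (P : finPOrderType d) (L : linext P) (k : 'I_#|P|) :
  k \in codom L.
Proof. by have [g _ gK] := linext_bij L; rewrite -(gK k) codom_f. Qed.

(* L^k = L^{-1}(k) *)
Definition linext_at d (P : finPOrderType d) (L : linext P) (k : 'I_#|P|) : P :=
  iinv (linext_codom L k).

Definition transposition_graph d (P : finPOrderType d) : rel (linext P) :=
  fun L L' => [exists a : 'I_#|P|, exists b : 'I_#|P|,
    (b == a.+1 :> nat) &&
    [forall c, linext_at L' c == linext_at L (tperm a b c)]].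

Definition jumps d (P : finPOrderType d) (L : linext P) : {set 'I_#|P|} :=
  [set k : 'I_#|P| | [exists k' : 'I_#|P|,
    (k' == k.+1 :> nat) && ~~ (linext_at L k < linext_at L k')%O]].

Definition avg_jump_number (R : realType) d (P : finPOrderType d) : R :=
  (\sum_(L : linext P) #|jumps L|%:R) / #|{: linext P}|%:R.

Definition degree (V : finType) (e : rel V) (v : V) : nat := #|[set w | e v w]|.

Definition avg_degree (R : realType) (V : finType) (e : rel V) : R :=
  (\sum_(v : V) (degree e v)%:R) / #|V|%:R.

(* [m]^n, with the chain [m] rendered as 0 < 1 < ... < m - 1. *)
Notation grid m n := (n.-tupleprod 'I_m).

Definition lg (R : realType) (x : R) : R := ln x / ln 2.

(* Main.v *)
Require Import Defs.
From mathcomp Require Import all_boot all_order all_algebra all_fingroup.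
From mathcomp Require Import reals sequences exp.
From mathcomp Require Import zify ring lra.

(** Write N for the size of the poset P = [m]^n, and call a position i of a
    linear extension L a stay when the element at i lies above the element at
    i - 1.  Every position other than the first is a stay or follows a jump, so
    the average number s of jumps and the average number t of stays satisfy
    s >= N - 1 - t, and it suffices to bound t from above.

    The idea is that stays make a linear extension cheap to describe, whereas
    the grid has so many linear extensions that most cannot be described
    cheaply.  When L is built one element at a time, the candidates for the
    next element form an antichain, and there are at most w = m^(n-1) of them,
    as deleting a coordinate is injective on antichains.  If the step is to be a
    stay, the next element must moreover cover the current one, which leaves at
    most n candidates.  Giving weight w to a stay and n to every other step,
    each step contributes at most 2nw in total, whence (sum_stays_weight)

      sum over L of w^(stays of L) * n^(N - stays of L) <= (2nw)^N.

    By convexity of exp the left-hand side is at least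
    e(P) * n^N * (w/n)^t, where e(P) is the number of linear extensions.

    In the other direction, sort the elements by rank (sum of coordinates) and
    break ties by an arbitrary ordering of P.  Together with the word of ranks
    that the arbitrary ordering spells out, the resulting linear extension
    determines that ordering; there are at most nm ranks, so
    N! <= e(P) * (nm)^N (fact_le_linext).  Since N^N <= 4^N * N! and N = wm, this
    gives e(P) >= (w/4n)^N.

    Combining both bounds, (w/n)^t <= (8n)^N, that is
    t * ln (w/n) <= N * ln (8n) <= 4 N ln n (avg_stays_le).  The claimed bound is
    not positive unless ln m > 48 ln n; in that range ln (w/n) >= (47/48) ln m, so t is
    at most a small multiple of N ln n / ln m, and the square root of a number in
    [0, 1] is at least that number (add_one_le_sqrt_bound).

    The first half of the theorem holds for each linear extension and in any
    poset: interchanging two consecutive elements gives a linear extension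
    exactly when they form a jump, and distinct jumps give distinct neighbours. *)

Set Implicit Arguments.
Unset Strict Implicit.
Unset Printing Implicit Defensive.

Import Order.TTheory GRing.Theory Num.Theory.
Local Open Scope nat_scope.

(** * Linear extensions as bijections onto positions *)

Lemma linext_atK d (P : finPOrderType d) (L : linext P) (k : 'I_#|P|) :
  L (linext_at L k) = k.
Proof. exact: f_iinv. Qed.

Lemma linext_inj d (P : finPOrderType d) (L : linext P) : injective L.
Proof. exact: bij_inj (linext_bij L). Qed.

Lemma linextK d (P : finPOrderType d) (L : linext P) : cancel L (linext_at L).
Proof. by move=> x; apply: (@linext_inj _ _ L); rewrite linext_atK. Qed.

Lemma linext_lt d (P : finPOrderType d) (L : linext P) (x y : P) :
  (x < y)%O -> L x < L y.
Proof.
move=> xy; have /andP[_ /forallP/(_ x)/forallP/(_ y)/implyP] := linextP L.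
exact.
Qed.

Lemma linext_eq d (P : finPOrderType d) (L L' : linext P) : L =1 L' -> L = L'.
Proof. by move=> eqL; apply/val_inj/ffunP. Qed.

Lemma is_linextI d (P : finPOrderType d) (f : {ffun P -> 'I_#|P|}) :
  injective f -> (forall x y, (x < y)%O -> f x < f y) -> is_linext f.
Proof.
move=> fI fM; apply/andP; split; first exact/injectiveP.
by apply/forallP => x; apply/forallP => y; apply/implyP/fM.
Qed.

(** * Degrees in the transposition graph *)

(** The only strict inequality that interchanging two consecutive values can
    break is the one between the two elements that carry them. *)
Lemma swap_is_linext d (P : finPOrderType d) (L : linext P) (a b : 'I_#|P|) :
  b = a.+1 :> nat -> ~~ (linext_at L a < linext_at L b)%O ->
  is_linext [ffun x => tperm a b (L x)].
Proof.
move=> ab nab; apply: is_linextI => [x y | x y xy].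
  by rewrite !ffunE => /perm_inj/linext_inj.
have Lxy : ~ (L x = a :> nat /\ L y = b :> nat).
  by case=> /val_inj Lx /val_inj Ly; rewrite -Lx -Ly !linextK xy in nab.
have neq (i j : 'I_#|P|) : i <> j -> i <> j :> nat by move=> + /val_inj.
have := linext_lt L xy; rewrite !ffunE; move: Lxy.
by case: tpermP => [->|->|/neq + /neq +]; case: tpermP => [->|->|/neq + /neq +]; lia.
Qed.

(** The last position has no successor and is sent to itself. *)
Definition succ_pos N (k : 'I_N) : 'I_N := insubd k k.+1.

Lemma val_succ_pos N (k k' : 'I_N) : k' = k.+1 :> nat -> succ_pos k = k'.
Proof. by move=> kk'; apply: val_inj; rewrite val_insubd -kk' ltn_ord. Qed.

Lemma jumpsP d (P : finPOrderType d) (L : linext P) (k : 'I_#|P|) :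
  reflect (succ_pos k = k.+1 :> nat /\
           ~~ (linext_at L k < linext_at L (succ_pos k))%O)
          (k \in jumps L).
Proof.
rewrite inE; apply: (iffP existsP) => [[k' /andP[/eqP kk' nk]] | [kk' nk]].
  by rewrite (val_succ_pos kk').
by exists (succ_pos k); rewrite kk' eqxx.
Qed.

(** A jump k is matched with the neighbour of L that interchanges the elements at
    positions k and k + 1. *)
Lemma degree_transposition_graph d (P : finPOrderType d) (L : linext P) :
  degree (@transposition_graph _ P) L = #|jumps L|.
Proof.
pose g k := insubd L [ffun x => tperm k (succ_pos k) (L x)].
have gE k x : k \in jumps L -> g k x = tperm k (succ_pos k) (L x).
  case/jumpsP => kS nk.
  have /(insubdK L) : [ffun x => tperm k (succ_pos k) (L x)] \in is_linext (P := P).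
    exact: swap_is_linext.
  by move/ffunP/(_ x); rewrite !ffunE.
rewrite -[RHS](card_in_imset (f := g)).
  congr #|pred_of_set _|; apply/setP => L'; rewrite inE.
  apply/existsP/imsetP => [[a /existsP[b /andP[/eqP ab /forallP LL']]] | [k kJ ->]].
    have L'E x : L' x = tperm a b (L x).
      rewrite -[x in LHS](linextK L) -{1}[L x](tpermK a b).
      by rewrite -(eqP (LL' _)) linext_atK.
    have aJ : a \in jumps L.
      apply/jumpsP; rewrite (val_succ_pos ab); split=> //.
      apply/negP => /(linext_lt L'); rewrite !L'E !linext_atK tpermL tpermR ab.
      by rewrite ltnNge leqnSn.
    by exists a => //; apply: linext_eq => x; rewrite gE // L'E (val_succ_pos ab).
  have [kS _] := jumpsP _ _ kJ.
  exists k; apply/existsP; exists (succ_pos k); rewrite kS eqxx /=.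
  apply/forallP => c; apply/eqP/(@linext_inj _ _ (g k)).
  by rewrite linext_atK gE // linext_atK tpermK.
move=> a b aJ bJ gab.
have [aS _] := jumpsP _ _ aJ; have [bS _] := jumpsP _ _ bJ.
(* Follow the element at position a: the two swaps must move it alike. *)
have := gE _ (linext_at L a) aJ; rewrite gab gE // linext_atK tpermL.
case: tpermP => [// | ab | _ _] /(congr1 val) /=; rewrite aS.
  by move: bS; rewrite -ab => -> bE; have := ltnn b; rewrite {2}bE ltnS leqnSn.
by move=> /eqP; rewrite eqn_leq ltnn andbF.
Qed.

(** * A lower bound on the number of linear extensions *)

(** Sorting the elements by an injective key: the position of x is the number of
    elements with a smaller key. *)
Lemma linext_of_key d (P : finPOrderType d) (key : P -> nat) :
  injective key -> (forall x y, (x < y)%O -> key x < key y) ->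
  {L : linext P | forall x y, (L x < L y) = (key x < key y)}.
Proof.
move=> keyI keyM.
pose below x := [set y | key y < key x].
have below_lt x : #|below x| < #|P|.
  rewrite -cardsT; apply: proper_card; rewrite properT.
  by apply/negP => /eqP/setP/(_ x); rewrite !inE ltnn.
pose f := [ffun x => Ordinal (below_lt x)].
have fE x y : (f x < f y) = (key x < key y).
  rewrite !ffunE /=; case: (ltnP (key x) (key y)) => [xy | yx].
    apply: proper_card; apply/properP; split.
      by apply/subsetP => z; rewrite !inE => /ltn_trans; apply.
    by exists x; rewrite !inE // ltnn.
  apply/negbTE; rewrite -leqNgt; apply: subset_leq_card.
  by apply/subsetP => z; rewrite !inE => /leq_trans; apply.
have fL : is_linext f.
  apply: is_linextI => [x y fxy | x y /keyM]; last by rewrite fE.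
  have := fE x y; have := fE y x; rewrite fxy !ltnn => /esym h1 /esym h2.
  by apply: keyI; lia.
by exists (LinExt fL).
Qed.

(** The power of l counts words of ranks.  An ordering s of P is sent to the linear
    extension that sorts P by rank, with ties broken by s, and to the word of the
    ranks met along s.  The word tells which positions of s hold elements of a
    given rank, and the linear extension tells in which order these elements fill
    them, so s can be recovered. *)
Lemma fact_le_linext d (P : finPOrderType d) l (r : P -> 'I_l) :
  (forall x y, (x < y)%O -> r x < r y) ->
  #|P|`! <= #|{: linext P}| * l ^ #|P|.
Proof.
move=> rM.
(* An ordering of P is encoded as a permutation s composed with enum_rank. *)
pose pos (s : {perm P}) x : nat := enum_rank (s x).
pose key s x := r x * #|P| + pos s x.
have pos_lt s x : pos s x < #|P| by exact: ltn_ord.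
have keyI s : injective (key s).
  move=> x y /(congr1 (modn^~ #|P|)); rewrite !modnMDl !modn_small //.
  by move/val_inj/enum_rank_inj/perm_inj.
have keyM s x y : (x < y)%O -> key s x < key s y.
  by move/rM => rxy; have := pos_lt s x; rewrite /key; nia.
pose code s := (sval (linext_of_key (@keyI s) (@keyM s)),
                [ffun z => r ((s^-1%g : {perm P}) z)]).
have rank_code s t x y : code s = code t -> r x = r y ->
    (pos s x < pos s y) = (pos t x < pos t y).
  case=> eqL _ rxy; move: eqL.
  case: linext_of_key => /= L LE; case: linext_of_key => /= L' L'E eqL.
  by have := L'E x y; rewrite -eqL LE /key rxy !ltn_add2l.
(* The positions before that of x which the word marks with the rank of x. *)
pose below s x := [set z | (r ((s^-1%g : {perm P}) z) == r x) && (enum_rank z < pos s x)].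
have card_below s x : #|below s x| = #|[set y | (r y == r x) && (pos s y < pos s x)]|.
  rewrite -(card_preimset _ (@perm_inj _ s)); apply: eq_card => y.
  by rewrite !inE permK.
have pos_le s t x : code s = code t -> pos s x <= pos t x.
  move=> st; rewrite leqNgt; apply/negP => ts.
  have : #|below t x| < #|below s x|.
    have wE z : r ((t^-1%g : {perm P}) z) = r ((s^-1%g : {perm P}) z).
      by case: st => _ /ffunP/(_ z); rewrite !ffunE.
    apply: proper_card; apply/properP; split.
      apply/subsetP => z; rewrite !inE wE => /andP[-> zt].
      exact: ltn_trans zt ts.
    exists (t x); rewrite !inE; last by rewrite ltnn andbF.
    by rewrite -wE permK eqxx.
  rewrite !card_below; set A := [set _ | _]; set B := [set _ | _].
  suff -> : A = B by rewrite ltnn.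
  by apply/setP => y; rewrite !inE; case: eqP => //= /(rank_code _ _ _ _ st).
have codeI : injective code.
  move=> s t st; apply/permP => x; apply/enum_rank_inj/val_inj.
  by apply/eqP; rewrite eqn_leq; apply/andP; split; exact: pos_le.
have -> : #|P|`! = #|{perm P}|.
  rewrite -[#|P|]cardsT -card_perm; apply: eq_card => s.
  by rewrite !inE; apply/subsetP => x _; rewrite inE.
have := leq_card code codeI.
by rewrite card_prod card_ffun card_ord.
Qed.

(** Both sides are compared with the falling factorial (2k)(2k - 1)...(k + 1),
    whose factors exceed k and which is a binomial coefficient (at most 4^k)
    times k!. *)
Lemma expnn_le_fact k : k ^ k <= 4 ^ k * k`!.
Proof.
have ffact_ge j : j <= k -> k ^ j <= (k + k) ^_ j.
  elim: j => [|j IH] jk; first by rewrite ffactn0.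
  by rewrite ffactnSr expnSr leq_mul ?IH ?(ltnW jk) //; lia.
apply: leq_trans (ffact_ge k (leqnn k)) _.
rewrite -bin_ffact leq_mul2r; apply/orP; right.
rewrite -[4]/(2 ^ 2) -expnM mul2n -addnn -[2]/(1 + 1) expnDn.
have kk : k < (k + k).+1 by rewrite ltnS leq_addr.
by rewrite (bigD1 (Ordinal kk)) //= !exp1n !muln1 leq_addr.
Qed.

(** * Counting linear extensions according to their stays *)

Definition stays d (P : finPOrderType d) (L : linext P) : {set 'I_#|P|} :=
  [set i : 'I_#|P| | [exists k : 'I_#|P|,
    (i == k.+1 :> nat) && (linext_at L k < linext_at L i)%O]].

(** A position other than 0 which is not a stay follows a jump. *)
Lemma card_stays_jumps d (P : finPOrderType d) (L : linext P) :
  #|P| <= #|stays L| + #|jumps L| + 1.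
Proof.
rewrite -[X in X <= _]card_ord -cardsT -addnA.
have -> : [set: 'I_#|P|] = stays L :|: ~: stays L by rewrite setUCr.
rewrite cardsU setICr cards0 subn0 leq_add2l.
have sub : ~: stays L \subset
    (@succ_pos #|P| @: jumps L) :|: [set i : 'I_#|P| | i == 0 :> nat].
  apply/subsetP => i; rewrite !inE.
  case: i => [[|k] ki]; first by rewrite orbT.
  move=> /existsPn nk; rewrite orbF.
  pose k' := Ordinal (ltnW ki).
  have kS : succ_pos k' = Ordinal ki by apply: val_succ_pos.
  apply/imsetP; exists k' => //; apply/jumpsP; rewrite kS; split=> //.
  by have := nk k'; rewrite eqxx.
apply: leq_trans (subset_leq_card sub) _.
apply: leq_trans (leq_card_setU _ _) _; apply: leq_add; first exact: leq_imset_card.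
apply/card_le1P => i; rewrite inE => /eqP i0 j; rewrite inE -[RHS]val_eqE /= i0 //.
Qed.

Definition covers d (P : finPOrderType d) (x : P) : {set P} :=
  [set y | (x < y)%O && [forall z, ~~ ((x < z)%O && (z < y)%O)]].

(** An element strictly between two consecutive ones would need a position
    strictly between theirs. *)
Lemma stay_covers d (P : finPOrderType d) (L : linext P) (k i : 'I_#|P|) :
  i = k.+1 :> nat -> (linext_at L k < linext_at L i)%O ->
  linext_at L i \in covers (linext_at L k).
Proof.
move=> ik ki; rewrite inE ki; apply/forallP => z; apply/negP => /andP[].
by move=> /(linext_lt L) + /(linext_lt L); rewrite !linext_atK; lia.
Qed.

Definition agree_below d (P : finPOrderType d) j (L L' : linext P) : bool :=
  [forall i : 'I_#|P|, (i < j) ==> (linext_at L' i == linext_at L i)].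

Lemma agree_belowP d (P : finPOrderType d) j (L L' : linext P) :
  reflect (forall i : 'I_#|P|, i < j -> linext_at L' i = linext_at L i)
          (agree_below j L L').
Proof.
by apply: (iffP forallP) => H i; [move=> ij; apply/eqP/(implyP (H i)) |
  apply/implyP => ij; apply/eqP/H].
Qed.

(** If the candidate chosen by L1 were below that chosen by L2, then L2 would have
    placed it earlier, in the part that is common to L1 and L2. *)
Lemma agree_below_next_antichain d (P : finPOrderType d) (L L1 L2 : linext P)
    (j : 'I_#|P|) :
  agree_below j L L1 -> agree_below j L L2 ->
  ~~ (linext_at L1 j < linext_at L2 j)%O.
Proof.
move=> /agree_belowP LL1 /agree_belowP LL2; apply/negP => lt12.
have := linext_lt L2 lt12; rewrite linext_atK; set i := L2 _ => ij.
have : linext_at L1 i = linext_at L1 j.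
  by rewrite LL1 // -LL2 // linextK.
by move=> /(can_inj (linext_atK L1)) eij; rewrite eij ltnn in ij.
Qed.

(** The weight of the possible completions of the first j values of L, by descending
    induction on j.  When the value y at position j is chosen, y is either a
    cover of the previous value, reached by a stay of weight w, or one of the
    antichain of possible next values, reached with weight c; as there are at
    most c of the former and w of the latter, the choices weigh at most 2cw. *)
Lemma prefix_weight (d : Order.disp_t) (P : finPOrderType d) (w c : nat) q j
    (L : linext P) :
  (forall A : {set P}, {in A &, forall x y, ~~ (x < y)%O} -> #|A| <= w) ->
  (forall x : P, #|covers x| <= c) ->
  j + q = #|P| ->
  \sum_(L' | agree_below j L L')
    \prod_(i < #|P| | j <= i) (if i \in stays L' then w else c)
  <= (2 * c * w) ^ q.
Proof.
move=> antichain_le covers_le; elim: q j L => [|q IH] j L jq.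
  rewrite (big_pred1 L) => [|L'].
    by rewrite big_pred0 // => i; have := ltn_ord i; lia.
  apply/agree_belowP/eqP => [H | -> //].
  apply: linext_eq => x; apply: (can_inj (linext_atK L)).
  have /H : L' x < j by have := ltn_ord (L' x); lia.
  by rewrite !linextK => <-.
have jP : j < #|P| by lia.
pose jj := Ordinal jP.
(* A stay leads from position j - 1 into C; every step leads into V. *)
pose C := [set y | [exists k : 'I_#|P|, (j == k.+1) && (y \in covers (linext_at L k))]].
pose V := [set y | [exists L', agree_below j L L' && (linext_at L' jj == y)]].
have C_le : #|C| <= c.
  case: (posnP j) => j0.
    by rewrite eq_card0 // => y; rewrite !inE; apply/existsP => -[k]; rewrite j0.
  have kP : j.-1 < #|P| by lia.
  apply: leq_trans (covers_le (linext_at L (Ordinal kP))).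
  apply: subset_leq_card; apply/subsetP => y; rewrite inE => /existsP[k /andP[/eqP jk]].
  by congr (y \in covers (linext_at L _)); apply: val_inj; rewrite /= jk.
have V_le : #|V| <= w.
  apply: antichain_le => x y; rewrite !inE.
  move=> /existsP[L1 /andP[LL1 /eqP <-]] /existsP[L2 /andP[LL2 /eqP <-]].
  exact: (@agree_below_next_antichain _ _ L).
rewrite (partition_big (fun L' => linext_at L' jj) predT) //=.
apply: (@leq_trans (\sum_y ((y \in C) * w + (y \in V) * c) * (2 * c * w) ^ q)).
  apply: leq_sum => y _.
  case: (pickP (fun L' => agree_below j L L' && (linext_at L' jj == y))); last first.
    by move=> H; rewrite big_pred0.
  move=> L1 /andP[LL1 /eqP L1y].
  apply: leq_trans (leq_mul (leqnn _) (IH j.+1 L1 _)); last by lia.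
  rewrite big_distrr /=.
  rewrite (eq_bigl (agree_below j.+1 L1)) => [|L']; last first.
    apply/andP/agree_belowP.
      case=> /agree_belowP LL' /eqP L'y i; rewrite ltnS leq_eqVlt => /orP[/eqP ij|ij].
        by have -> : i = jj by [exact: val_inj]; rewrite L'y L1y.
      by rewrite LL' // (agree_belowP _ _ _ LL1).
    move=> LL'; split; last by rewrite LL' //= L1y.
    apply/agree_belowP => i ij; rewrite LL' ?(agree_belowP _ _ _ LL1) //.
    exact: leq_trans ij _.
  apply: leq_sum => L' /agree_belowP LL'.
  have L'y : linext_at L' jj = y by rewrite LL' //=.
  have L'L (i : 'I_#|P|) : i < j -> linext_at L' i = linext_at L i.
    by move=> ij; rewrite LL' ?(agree_belowP _ _ _ LL1) // (leq_trans ij).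
  rewrite (bigD1 jj) //=; apply: leq_mul; last first.
    rewrite (eq_bigl (fun i : 'I_#|P| => j < i)) // => i.
    by rewrite -val_eqE /= ltn_neqAle andbC eq_sym.
  case: ifPn => [|_]; last first.
    have -> : y \in V.
      rewrite inE; apply/existsP; exists L'; rewrite L'y eqxx andbT.
      exact/agree_belowP.
    by rewrite mul1n leq_addl.
  rewrite inE => /existsP[k /andP[/eqP /= jk kj]].
  have -> : y \in C.
    rewrite inE; apply/existsP; exists k; rewrite jk eqxx /= -L'L ?jk //.
    by rewrite -L'y; apply: stay_covers.
  by rewrite mul1n leq_addr.
rewrite -big_distrl /= expnS leq_mul2r; apply/orP; right.
rewrite big_split /= -!big_distrl /= -!big_mkcond /= !sum1_card.
nia.
Qed.

Lemma sum_stays_weight (d : Order.disp_t) (P : finPOrderType d) (w c : nat) :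
  (forall A : {set P}, {in A &, forall x y, ~~ (x < y)%O} -> #|A| <= w) ->
  (forall x : P, #|covers x| <= c) ->
  \sum_(L : linext P) w ^ #|stays L| * c ^ (#|P| - #|stays L|)
  <= (2 * c * w) ^ #|P|.
Proof.
move=> antichain_le covers_le.
case: (pickP (fun _ : linext P => true)) => [L0 _ | H]; last by rewrite big_pred0.
apply: leq_trans (prefix_weight L0 antichain_le covers_le (add0n #|P|)).
rewrite [leqRHS](eq_bigl xpredT) => [|L]; last exact/agree_belowP.
apply: leq_sum => L _.
rewrite (bigID (mem (stays L))) /=.
rewrite (eq_bigr (fun=> w)) => [|i ->] //.
rewrite [X in _ <= _ * X](eq_bigr (fun=> c)); last first.
  by move=> i /negbTE ->.
rewrite !prod_nat_const leq_mul // leq_eqVlt; apply/orP; left; apply/eqP.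
congr (_ ^ _); have := cardC (stays L); rewrite card_ord => {1}<-; rewrite addKn.
by apply: eq_card.
Qed.

(** * The grid *)

Lemma card_grid m n : #|{: grid m n}| = m ^ n.
Proof. by rewrite card_tuple card_ord. Qed.

(** Two points that differ only in the first coordinate are comparable, so deleting
    it is injective on an antichain. *)
Lemma grid_antichain_le m n (A : {set grid m n.+1}) :
  {in A &, forall x y, ~~ (x < y)%O} -> #|A| <= m ^ n.
Proof.
move=> Aanti.
pose f (t : grid m n.+1) := [tuple tnth t (lift ord0 i) | i < n].
rewrite -[X in X ^ n]card_ord -card_tuple -(card_in_imset (f := f)).
  exact: max_card.
move=> x y xA yA fxy.
have tailE i : tnth x (lift ord0 i) = tnth y (lift ord0 i).
  by have := congr1 (fun t => tnth t i) fxy; rewrite !tnth_mktuple.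
have lt_head u v : (forall i, tnth u (lift ord0 i) = tnth v (lift ord0 i)) ->
    (tnth u ord0 < tnth v ord0)%O -> (u < v :> grid m n.+1)%O.
  move=> uv uv0; rewrite ltEtprod; apply/andP; split.
    by apply/existsP; exists ord0.
  apply/forallP => i; case: (unliftP ord0 i) => [j|] ->; last exact: ltW.
  by rewrite uv.
apply: eq_from_tnth => i; case: (unliftP ord0 i) => [j|] ->; first exact: tailE.
apply/eqP; case: ltgtP => // xy.
  by have := Aanti x y xA yA; rewrite lt_head.
by have := Aanti y x yA xA; rewrite lt_head.
Qed.

(** Every point above x lies above one of the at most n points obtained from x by
    raising one coordinate by 1. *)
Lemma grid_covers_le m n (x : grid m n) : #|covers x| <= n.
Proof.
(* At the top of the chain insubd leaves the coordinate unchanged. *)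
pose up i : grid m n := [tuple insubd (tnth x j) (tnth x j + (i == j)) | j < n].
apply: (@leq_trans #|up @: [set: 'I_n]|); last first.
  by rewrite (leq_trans (leq_imset_card _ _)) // cardsT card_ord.
apply: subset_leq_card; apply/subsetP => y; rewrite inE => /andP[xy /forallP noz].
move: (xy); rewrite ltEtprod => /andP[/existsP[i xyi] /forallP xyle].
have upE j : tnth (up i) j = tnth x j + (i == j) :> nat.
  rewrite tnth_mktuple val_insubd; case: eqP => [<-|_]; last by rewrite addn0 ltn_ord.
  by move: xyi; rewrite ltEord /= => xyi; rewrite addn1 (leq_ltn_trans xyi) ?ltn_ord.
have xup : (x < up i)%O.
  rewrite ltEtprod; apply/andP; split.
    by apply/existsP; exists i; rewrite ltEord /= upE eqxx addn1.
  by apply/forallP => j; rewrite leEord /= upE leq_addr.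
have upy : (up i <= y)%O.
  rewrite leEtprod; apply/forallP => j; rewrite leEord /= upE.
  case: eqP => [<-|_]; last by rewrite addn0; have := xyle j; rewrite leEord.
  by move: xyi; rewrite ltEord /= addn1.
apply/imsetP; exists i => //.
have := noz (up i); rewrite xup /= lt_neqAle upy andbT negbK => /eqP ->//.
Qed.

Lemma grid_rank_lt m n (x : grid m n.+1) : \sum_(i < n.+1) tnth x i < n.+1 * m.
Proof.
have : \sum_(i < n.+1) (tnth x i).+1 <= \sum_(i < n.+1) m.
  by apply: leq_sum => i _; exact: ltn_ord.
rewrite sum_nat_const card_ord.
under eq_bigr do rewrite -addn1.
by rewrite big_split /= sum_nat_const card_ord; lia.
Qed.

Lemma grid_rank_mono m n (x y : grid m n) :
  (x < y)%O -> \sum_(i < n) tnth x i < \sum_(i < n) tnth y i.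
Proof.
rewrite ltEtprod => /andP[/existsP[i xyi] /forallP xyle].
rewrite (bigD1 i) //= [X in _ < X](bigD1 i) //= -addSn leq_add //.
by apply: leq_sum => j _; have := xyle j; rewrite leEord.
Qed.

(** * From counting to averages *)

Local Open Scope ring_scope.

(** Jensen's inequality for exp, by summing the tangent line bound at the mean. *)
Lemma expR_mean_le (R : realType) (T : finType) (f : T -> R) :
  (0 < #|T|)%N ->
  #|T|%:R * expR ((\sum_x f x) / #|T|%:R) <= \sum_x expR (f x).
Proof.
move=> T0; set t := _ / _.
have T0' : #|T|%:R != 0 :> R by rewrite pnatr_eq0 -lt0n.
have -> : #|T|%:R * expR t = \sum_x expR t * (1 + (f x - t)).
  rewrite -big_distrr /= big_split /= sumrB !sumr_const.
  rewrite -(mulr_natl t) -[X in _ * (X *+ _ + _)]/(1 : R).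
  rewrite /t mulrCA divff // mulr1 subrr addr0.
  by rewrite mulrC.
apply: ler_sum => x _.
have := ler_wpM2l (expR_ge0 t) (expR_ge1Dx (f x - t)).
by move=> /le_trans; apply; rewrite -expRD addrC subrK.
Qed.

Lemma linext_gt0 d (P : finPOrderType d) l (r : P -> 'I_l) :
  (forall x y, (x < y)%O -> (r x < r y)%N) -> (0 < #|{: linext P}|)%N.
Proof.
move=> rM; rewrite lt0n; apply/eqP => e0.
by have := fact_le_linext rM; rewrite e0 mul0n leqNgt fact_gt0.
Qed.

Definition avg_stays (R : realType) d (P : finPOrderType d) : R :=
  (\sum_(L : linext P) #|stays L|%:R) / #|{: linext P}|%:R.

Lemma avg_jump_number_ge (R : realType) d (P : finPOrderType d) :
  (0 < #|{: linext P}|)%N ->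
  #|P|%:R - 1 - avg_stays R P <= avg_jump_number R P.
Proof.
move=> e0; have e0' : 0 < #|{: linext P}|%:R :> R by rewrite ltr0n.
rewrite /avg_stays /avg_jump_number ler_pdivlMr // mulrBl mulfVK ?gt_eqF //.
rewrite lerBlDr -big_split /= mulrC -sum1_card natr_sum big_distrl /=.
apply: ler_sum => L _; rewrite mul1r lerBlDr -natrD natr1 ler_nat.
by rewrite addnC -addn1 card_stays_jumps.
Qed.

(** With a = ln (w/c), convexity turns sum_stays_weight into
    e(P) * exp (t * a) <= (2w)^N for the mean t of the number of stays, where
    N is the size of P, and e(P), the number of linear extensions, is at least
    (N/4l)^N. *)
Lemma avg_stays_le (R : realType) d (P : finPOrderType d) (w c l : nat)
    (r : P -> 'I_l) :
  (0 < #|P|)%N -> (0 < w)%N -> (0 < c)%N ->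
  (forall A : {set P}, {in A &, forall x y, ~~ (x < y)%O} -> (#|A| <= w)%N) ->
  (forall x : P, (#|covers x| <= c)%N) ->
  (forall x y, (x < y)%O -> (r x < r y)%N) ->
  avg_stays R P * ln (w%:R / c%:R)
    <= #|P|%:R * ln (8 * w%:R * l%:R / #|P|%:R).
Proof.
move=> P0 w0 c0 wP cP rM.
have l0 : (0 < l)%N.
  by case/card_gt0P: P0 => x _; exact: leq_ltn_trans (ltn_ord (r x)).
have e0 := linext_gt0 rM.
set N := #|P| in P0 *; set a := ln _; set e := #|{: linext P}| in e0.
have [wR cR lR NR] : [/\ 0 < w%:R :> R, 0 < c%:R :> R, 0 < l%:R :> R & 0 < N%:R :> R].
  by rewrite !ltr0n.
have count_le : (N%:R ^+ N <= (4 * l%:R) ^+ N * e%:R :> R).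
  rewrite -[4]/(4%:R) -natrM -!natrX -natrM ler_nat.
  apply: leq_trans (expnn_le_fact N) _; rewrite expnMn -mulnA leq_mul2l.
  by apply/orP; right; rewrite mulnC; exact: fact_le_linext rM.
have weight_le : \sum_(L : linext P) expR (#|stays L|%:R * a) <= (2 * w%:R) ^+ N.
  rewrite -(ler_pM2l (exprn_gt0 N cR)) -exprMn big_distrr /=.
  have -> : c%:R * (2 * w%:R) = (2 * c * w)%N%:R :> R by rewrite !natrM; ring.
  have h := sum_stays_weight wP cP; rewrite -(ler_nat R) natrX in h.
  apply: le_trans h; rewrite natr_sum; apply: ler_sum => L _.
  have sN : (#|stays L| <= N)%N by rewrite -[N]card_ord max_card.
  rewrite expRM_natl lnK ?posrE ?divr_gt0 // natrM !natrX.
  rewrite -{1}(subnK sN) exprD expr_div_n.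
  have : c%:R ^+ #|stays L| != 0 :> R by rewrite expf_neq0 ?gt_eqF.
  move: (_ ^+ _) (_ ^+ _) (_ ^+ _) => x y z y0.
  by rewrite le_eqVlt; apply/orP; left; apply/eqP; field.
have mean_le : e%:R * expR (avg_stays R P * a) <= (2 * w%:R) ^+ N.
  apply: le_trans weight_le; rewrite /avg_stays mulrAC big_distrl /=.
  exact: expR_mean_le.
have K0 : 0 < 8 * w%:R * l%:R / N%:R :> R by rewrite divr_gt0 ?mulr_gt0.
rewrite -ler_expR expRM_natl lnK ?posrE // expr_div_n ler_pdivlMr ?exprn_gt0 //.
have -> : 8 * w%:R * l%:R = (4 * l%:R) * (2 * w%:R) :> R by ring.
rewrite exprMn.
apply: le_trans (ler_wpM2l (expR_ge0 _) count_le) _.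
rewrite mulrCA ler_wpM2l ?exprn_ge0 ?mulr_ge0 //.
by rewrite mulrC.
Qed.

(** Here t is the average number of stays and x = 48 ln n / ln m < 1.  As 8n <= n^4,
    the hypothesis gives t <= N * 4 ln n / ((47/48) ln m) = (4/47) x N; as ln n >= 1/2
    and ln m <= m <= N, x N >= 24 and the remaining 1 is also a small fraction of
    x N; and x <= sqrt x. *)
Lemma add_one_le_sqrt_bound (R : realType) (n m N : nat) (t : R) :
  (2 <= n)%N -> (m * m <= N)%N -> 48 * ln n%:R < ln m%:R :> R ->
  t * (ln m%:R - ln n%:R) <= N%:R * ln (8 * n%:R) ->
  t + 1 <= N%:R * Num.sqrt (48 * lg (n%:R : R) / lg (m%:R : R)).
Proof.
move=> n2 mN nm tle.
have nR : 2 <= n%:R :> R by rewrite (ler_nat R 2).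
have ln_n : 2^-1 <= ln n%:R :> R.
  have h : ln (1 + (n%:R^-1 - 1)) <= n%:R^-1 - 1 :> R.
    by apply: le_ln1Dx; rewrite ltrBrDr addrC subrr invr_gt0; lra.
  have : n%:R^-1 <= 2^-1 :> R by rewrite lef_pV2 ?posrE //; lra.
  move: h; rewrite addrC subrK lnV ?posrE; lra.
have ln8n : ln (8 * n%:R) <= 4 * ln n%:R :> R.
  rewrite [leRHS]mulr_natl -lnXn; last lra.
  rewrite ler_ln ?posrE ?exprn_gt0 ?mulr_gt0 //; try lra.
  rewrite -[8]/((2 ^ 3)%:R) -natrM -natrX ler_nat (expnSr n 3).
  by rewrite leq_mul2r leq_exp2r // n2 orbT.
have m0 : (0 < m)%N.
  rewrite lt0n; apply/eqP => m0; move: nm; rewrite m0 [ln 0%:R]ln0 // => nm; lra.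
have ln_m : ln m%:R <= m%:R :> R.
  have h : ln (1 + (m%:R - 1)) <= m%:R - 1 :> R.
    by apply: le_ln1Dx; rewrite ltrBrDr addrC subrr ltr0n.
  by move: h; rewrite addrC subrK; lra.
have mNR : m%:R <= N%:R :> R by rewrite ler_nat; nia.
set a := ln n%:R in ln_n ln8n nm tle *; set b := ln m%:R in nm ln_m tle *.
have b0 : 0 < b by lra.
have ln2 : ln 2 != 0 :> R by rewrite gt_eqF // ln_gt0 // ltr1n.
have -> : 48 * lg (n%:R : R) / lg (m%:R : R) = 48 * a / b.
  by rewrite /lg -/a -/b invf_div -!mulrA; congr (_ * (_ * _)); rewrite mulrCA mulVKf //.
have x1 : 48 * a / b <= 1 by rewrite ler_pdivrMr // mul1r ltW.
have x0 : 0 <= 48 * a / b by rewrite divr_ge0 //; lra.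
have xs : 48 * a / b <= Num.sqrt (48 * a / b).
  rewrite -{1}(sqr_sqrtr x0) expr2 ler_piMr ?sqrtr_ge0 //.
  by rewrite -[leRHS]sqrtr1 ler_wsqrtr.
apply: le_trans (ler_wpM2l (ler0n _ _) xs).
rewrite !mulrA ler_pdivlMr //.
have : t * (b - a) <= N%:R * (4 * a) by apply: le_trans tle _; rewrite ler_wpM2l.
have [t0|t0] := lerP 0 t.
  have : t * (47 / 48 * b) <= t * (b - a) by rewrite ler_wpM2l //; lra.
  have : N%:R * 2^-1 <= N%:R * a by rewrite ler_wpM2l.
  have : 0 <= N%:R :> R by [].
  move: (N%:R * a) => Na; nra.
have : N%:R * 2^-1 <= N%:R * a by rewrite ler_wpM2l.
have : 0 <= N%:R :> R by [].
move: (N%:R * a) => Na; nra.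
Qed.

(** * The average jump number of the grid *)

Theorem theorem5 (R : realType) (n m : nat) (hn : (2 <= n)%N) (hm : (41 <= m)%N) :
  avg_degree R (@transposition_graph _ (grid m n)) = avg_jump_number R (grid m n)
  /\ avg_jump_number R (grid m n) >=
     m%:R ^+ n * (1 - Num.sqrt (48 * lg (n%:R : R) / lg (m%:R : R))).
Proof.
split.
  rewrite /avg_degree /avg_jump_number; congr (_ / _).
  by apply: eq_bigr => L _; rewrite degree_transposition_graph.
have m0 : (0 < m)%N by exact: leq_trans hm.
case: n hn => // n' hn; set n := n'.+1 in hn *.
pose r (x : grid m n) := Ordinal (grid_rank_lt x).
have rM (x y : grid m n) : (x < y)%O -> (r x < r y)%N by exact: grid_rank_mono.
have lnm : 0 < ln m%:R :> R by rewrite ln_gt0 // ltr1n (leq_trans _ hm).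
(* If lg m <= 48 lg n, the asserted lower bound is not positive. *)
have [small | big] := lerP (ln m%:R) (48 * ln n%:R :> R).
  apply: (@le_trans _ _ 0).
    rewrite pmulr_rle0 ?exprn_gt0 ?ltr0n // subr_le0 -{1}[1]sqrtr1 ler_wsqrtr //.
    have ln2 : 0 < ln 2 :> R by rewrite ln_gt0 // ltr1n.
    by rewrite /lg ler_pdivlMr ?divr_gt0 // mul1r mulrA ler_pM2r ?invr_gt0.
  by rewrite divr_ge0 ?sumr_ge0.
have wP := @grid_antichain_le m n'.
have NE : #|{: grid m n}| = (m ^ n)%N := card_grid m n.
have N0 : (0 < #|{: grid m n}|)%N by rewrite NE expn_gt0 m0.
have w0 : (0 < m ^ n')%N by rewrite expn_gt0 m0.
have n0 : (0 < n)%N by [].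
have st := avg_stays_le R N0 w0 n0 wP (@grid_covers_le m n) rM.
have jn := avg_jump_number_ge R (linext_gt0 rM).
rewrite -natrX -NE mulrBr mulr1.
apply: le_trans jn; rewrite -addrA lerD2l -opprD lerN2 addrC.
apply: add_one_le_sqrt_bound => //.
  rewrite NE /n expnS leq_mul2l; apply/orP; right.
  by rewrite -[leqLHS]expn1 leq_pexp2l //; lia.
have mR : 0 < m%:R :> R by rewrite ltr0n.
have nR : 0 < n%:R :> R by rewrite ltr0n.
have wR : 0 < (m ^ n')%N%:R :> R by rewrite ltr0n.
have -> : 8 * n%:R = 8 * (m ^ n')%N%:R * (n * m)%N%:R / #|{: grid m n}|%:R :> R.
  rewrite NE /n expnS !natrM; field; lra.
apply: le_trans st; rewrite ler_wpM2l //.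
  by rewrite divr_ge0 // sumr_ge0.
rewrite ln_div ?posrE // lerD2r ler_ln ?posrE // ler_nat.
by rewrite -[leqLHS]expn1 leq_pexp2l //; lia.
Qed.
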